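(* Let $\mathbb{F}$ be a field, let $k\ge 1$, let $V_1,\dots,V_k$ be finite-dimensional $\mathbb{F}$-vector spaces, let $s\in V_1\otimes\cdots\otimes V_k$ be a $k$-tensor, and let $n\ge 1$ and $d,e\ge 0$ be integers. (1) If $|\mathbb{F}|\ge ne+2$, then $\mathrm{R}(s^{\otimes n})\le (ne+1)\,\mathrm{R}^e(s)^n$. (2) If $|\mathbb{F}|\ge (k-1)nd+2$, then $\mathrm{R}(s^{\otimes n})\le ((k-1)nd+1)\,\mathrm{R}_d(s)^n$.
   Context: A $k$-tensor is an element of a tensor product of $k$ finite-dimensional $\mathbb{F}$-vector spaces. The tensor rank $\mathrm{R}(t)$ is the smallest $r$ such that $t$ is a sum of $r$ simple tensors $u_1\otimes\cdots\otimes u_k$. The tensor power $s^{\otimes n}$ is regarded as a $kn$-tensor in $(V_1\otimes\cdots\otimes V_k)^{\otimes n}$ (no factors are grouped). Degeneration: for $k$-tensors $t\in U_1\otimes\cdots\otimes U_k$ and $s\in V_1\otimes\cdots\otimes V_k$ and nonnegative integers $d,e$, write $t\unrhd_d^e s$ if there are linear maps $A_i(\varepsilon):U_i\to V_i$ depending polynomially on a formal variable $\varepsilon$ (matrices with entries in $\mathbb{F}[\varepsilon]$) such that $(A_1(\varepsilon)\otimes\cdots\otimes A_k(\varepsilon))t=\varepsilon^d s+\varepsilon^{d+1}s_1+\cdots+\varepsilon^{d+e}s_e$ for some tensors $s_1,\dots,s_e\in V_1\otimes\cdots\otimes V_k$. Write $t\unrhd^e s$ if $t\unrhd_d^e s$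 for some $d$, and $t\unrhd_d s$ if $t\unrhd_d^e s$ for some $e$. Let $\mathrm{T}_r(k)=\sum_{i=1}^r b_i^{\otimes k}\in(\mathbb{F}^r)^{\otimes k}$ where $b_1,\dots,b_r$ is the standard basis of $\mathbb{F}^r$. Define $\mathrm{R}^e(s)=\min\{r:\mathrm{T}_r(k)\unrhd^e s\}$ and $\mathrm{R}_d(s)=\min\{r:\mathrm{T}_r(k)\unrhd_d s\}$. *)

(* Defs.v *)
From HB Require Import structures.
From mathcomp Require Import all_boot all_order all_algebra.
From mathcomp Require Import boolp classical_sets functions cardinality.

Set Implicit Arguments.
Unset Strict Implicit.
Unset Printing Implicit Defensive.

Import GRing.Theory.
Local Open Scope ring_scope.

(* Least natural number satisfying P; the default value 0 is returned when    *)
(* there is none, which never occurs below as soon as there is at least one   *)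
(* tensor factor (tensor_rank_attained, error_degree_rank_attained,           *)
(* approx_degree_rank_attained).                                              *)
Definition least (P : nat -> Prop) : nat :=
  if pselect (exists n, `[< P n >]) is left exP then ex_minn exP else 0%N.

Lemma leastP (P : nat -> Prop) :
  (exists n, P n) -> P (least P) /\ forall m, P m -> (least P <= m)%N.
Proof.
move=> [n Pn]; rewrite /least; case: pselect => [exP|]; last first.
  by case; exists n; apply/asboolP.
by case: ex_minnP => m /asboolP Pm le_m; split=> // p /asboolP; apply: le_m.
Qed.

Section Tensors.
Variables (F : fieldType) (I : finType).
Implicit Types V U : I -> vectType F.

(* The tensor product of a finite family of finite-dimensional spaces is      *)
(* realized by coordinate arrays in the bases vbasis {:V i}. Together with    *)
(* the map simple_tensor it has the universal property of the tensor product, *)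
(* see tensor_universal.                                                      *)
Definition mindex V := {dffun forall i : I, 'I_(\dim {:V i})}.

Definition tensor V := {ffun mindex V -> F^o}.
HB.instance Definition _ V := GRing.Lmodule.on (tensor V).

Definition simple_tensor V (v : forall i, V i) : tensor V :=
  [ffun b : mindex V => \prod_i coord (vbasis {:V i}) (b i) (v i)].

Definition basis_family V (b : mindex V) : forall i, V i :=
  fun i => (vbasis {:V i})`_(b i).

Lemma coord_vbasisf (W : vectType F) (a c : 'I_(\dim {:W})) :
  coord (vbasis {:W}) c (vbasis {:W})`_a = (c == a)%:R.
Proof. by rewrite coord_free ?(basis_free (vbasisP _)) // eq_sym. Qed.

Lemma simple_basis_family V (b c : mindex V) :
  simple_tensor (basis_family b) c = (c == b)%:R.
Proof.
rewrite ffunE; under eq_bigr do rewrite coord_vbasisf.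
case: eqVneq => [->|neq_cb]; first by rewrite big1 // => i _; rewrite eqxx.
have [i neqi] : exists i, c i != b i.
  apply/existsP; rewrite -negb_forall; apply: contraNN neq_cb => /forallP eq_cb.
  by apply/eqP/ffunP => i; apply/eqP.
by rewrite (bigD1 i) //= (negPf neqi) mul0r.
Qed.

Lemma tensor_basis_sum V (t : tensor V) :
  t = \sum_(b : mindex V) t b *: simple_tensor (basis_family b).
Proof.
apply/ffunP => c; rewrite sum_ffunE (bigD1 c) //= big1 => [|b neq_bc].
  by rewrite ffunE simple_basis_family eqxx addr0 [_ *: _]mulr1.
by rewrite ffunE simple_basis_family eq_sym (negPf neq_bc) scaler0.
Qed.

Definition multilinear V (W : lmodType F) (f : (forall i, V i) -> W) : Prop :=
  forall (v : forall i, V i) (i : I) (a : F) (x y : V i),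
    f (dfwith v (a *: x + y)) = a *: f (dfwith v x) + f (dfwith v y).

Lemma multilinear0 V (W : lmodType F) (f : (forall i, V i) -> W) v i :
  multilinear f -> f (dfwith v (0 : V i)) = 0.
Proof.
move=> /(_ v i 1 0 0); rewrite !scale1r addr0 => /eqP.
by rewrite -subr_eq0 opprD addrA subrr sub0r oppr_eq0 => /eqP.
Qed.

Lemma simple_tensor_multilinear V : multilinear (@simple_tensor V).
Proof.
move=> v i a x y; apply/ffunP => b; rewrite !ffunE.
have E z : \prod_j coord (vbasis {:V j}) (b j) (dfwith v z j) =
    coord (vbasis {:V i}) (b i) z *
    \prod_(j | j != i) coord (vbasis {:V j}) (b j) (v j).
  rewrite (bigD1 i) //= dfwith_in; congr (_ * _); apply: eq_bigr => j neq_ji.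
  by rewrite dfwith_out // eq_sym.
by rewrite !E linearP /= mulrDl -mulrA.
Qed.

Lemma multilinear_basis0 V (W : lmodType F) (f : (forall i, V i) -> W) :
  multilinear f -> (forall b, f (basis_family b) = 0) -> forall v, f v = 0.
Proof.
move=> f_lin f0 v.
have {f0} f0 (w : forall i, V i) :
    (forall i, exists a : 'I_(\dim {:V i}), w i = (vbasis {:V i})`_a) -> f w = 0.
  move=> wb; rewrite -(f0 [ffun i => projT1 (cid (wb i))]); congr f.
  apply: functional_extensionality_dep => i; rewrite /basis_family ffunE.
  by case: cid.
have : forall i, i \notin enum I ->
    exists a : 'I_(\dim {:V i}), v i = (vbasis {:V i})`_a.
  by move=> i; rewrite mem_enum.
elim: (enum I) v => [|i r IHr] v vb; first by apply: f0 => i; exact: vb.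
have fS (x y : V i) (a : F) := f_lin v i a x y.
have fsum n (c : 'I_n -> F) (x : 'I_n -> V i) :
    f (dfwith v (\sum_(j < n) c j *: x j)) = \sum_(j < n) c j *: f (dfwith v (x j)).
  have f00 := multilinear0 v i f_lin.
  elim/big_rec2: _ => // j y x' _ <-; exact: fS.
have -> : v = dfwith v (v i).
  by apply: functional_extensionality_dep => j; case: dfwithP.
rewrite [v i](coord_vbasis (memvf _)) fsum big1 // => j _.
rewrite IHr ?scaler0 // => l; case: dfwithP => [_|l' neq_il l'r]; first by exists j.
by apply: vb; rewrite inE negb_or eq_sym neq_il.
Qed.

Lemma tensor_universal V (W : lmodType F) (f : (forall i, V i) -> W) :
  multilinear f ->
  exists g : {linear tensor V -> W},
    (forall v, g (simple_tensor v) = f v) /\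
    forall h : {linear tensor V -> W},
      (forall v, h (simple_tensor v) = f v) -> h =1 g.
Proof.
move=> f_lin.
pose g0 (t : tensor V) : W := \sum_(b : mindex V) t b *: f (basis_family b).
have g0_lin : linear g0.
  move=> a x y; rewrite /g0 scaler_sumr -big_split /=; apply: eq_bigr => b _.
  by rewrite !ffunE scalerDl scalerA.
pose g : {linear tensor V -> W} :=
  HB.pack g0 (GRing.isLinear.Build F (tensor V) W *:%R g0 g0_lin).
have g0b b : g (simple_tensor (basis_family b)) = f (basis_family b).
  rewrite /= /g0 (bigD1 b) //= big1 => [|c neq_cb].
    by rewrite simple_basis_family eqxx scale1r addr0.
  by rewrite simple_basis_family (negPf neq_cb) scale0r.
exists g; split=> [v|h hf t].
  apply/eqP; rewrite -subr_eq0; apply/eqP.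
  apply: (@multilinear_basis0 V W (fun v => g (simple_tensor v) - f v)).
    move=> w i a x y; rewrite simple_tensor_multilinear f_lin linearP scalerBr.
    by rewrite opprD !addrA; congr (_ + _); rewrite -!addrA; congr (_ + _); exact: addrC.
  by move=> b; rewrite g0b subrr.
rewrite [t]tensor_basis_sum !linear_sum; apply: eq_bigr => b _.
by rewrite !linearZ hf g0b.
Qed.

Definition sum_of_simple V (t : tensor V) (r : nat) : Prop :=
  exists u : 'I_r -> forall i, V i, t = \sum_(j < r) simple_tensor (u j).

Definition tensor_rank V (t : tensor V) : nat := least (sum_of_simple t).

Lemma tensor_rank_attained V (t : tensor V) : (0 < #|I|)%N ->
  sum_of_simple t (tensor_rank t) /\
  forall r, sum_of_simple t r -> (tensor_rank t <= r)%N.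
Proof.
move=> /card_gt0P[i0 _]; apply: leastP; exists #|{: mindex V}|.
exists (fun j => dfwith (basis_family (enum_val j))
          (t (enum_val j) *: basis_family (enum_val j) i0)).
rewrite {1}[t]tensor_basis_sum (reindex_onto enum_val enum_rank) => [|b _]; last first.
  exact: enum_rankK.
apply: eq_big => [j|j _]; first by rewrite enum_valK eqxx.
set b := enum_val j.
rewrite -[t b *: basis_family b i0]addr0 simple_tensor_multilinear multilinear0 ?addr0; last first.
  exact: simple_tensor_multilinear.
congr (_ *: simple_tensor _); apply: functional_extensionality_dep => i.
by case: dfwithP.
Qed.

(* The action of (\bigotimes_i A i) on t, with value in the extension of      *)
(* scalars of tensor V to F[epsilon], where epsilon is 'X. As everywhere in   *)
(* the library, matrices act on row vectors of coordinates.                   *)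
Definition tensor_act U V
    (A : forall i, 'M[{poly F}]_(\dim {:U i}, \dim {:V i})) (t : tensor U)
    : {ffun mindex V -> {poly F}} :=
  [ffun b : mindex V =>
     \sum_(a : mindex U) (\prod_i A i (a i) (b i)) * (t a : F)%:P].

Definition degenerates U V (t : tensor U) (s : tensor V) (d e : nat) : Prop :=
  exists (A : forall i, 'M[{poly F}]_(\dim {:U i}, \dim {:V i}))
         (s_ : nat -> tensor V),
    forall b : mindex V,
      tensor_act A t b = (s b : F)%:P * 'X^d +
                         \sum_(1 <= j < e.+1) (s_ j b : F)%:P * 'X^(d + j).

Definition unit_tensor (r : nat) : tensor (fun _ : I => 'rV[F]_r) :=
  \sum_(j < r) simple_tensor (fun _ : I => delta_mx 0 j : 'rV[F]_r).

(* R^e *)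
Definition error_degree_rank V (e : nat) (s : tensor V) : nat :=
  least (fun r => exists d, degenerates (unit_tensor r) s d e).

(* R_d *)
Definition approx_degree_rank V (d : nat) (s : tensor V) : nat :=
  least (fun r => exists e, degenerates (unit_tensor r) s d e).

Lemma prod_sum_mindex (R : comNzRingType) V
    (G : forall i, 'I_(\dim {:V i}) -> R) :
  \prod_i \sum_a G i a = \sum_(b : mindex V) \prod_i G i (b i).
Proof.
pose g i := finfun (G i).
transitivity (\prod_i \sum_(j in tagged_with (fun i => 'I_(\dim {:V i})) i)
                untag 0 (g i) j).
  apply: eq_bigr => i _; rewrite -(big_tag (fun i => g i)).
  by apply: eq_bigr => c _; rewrite ffunE.
rewrite (bigA_distr_big_dep (fun i => [in tagged_with _ i])).
rewrite -(big_fprod _ _ g).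
rewrite (reindex (@fprod_of_dffun I (fun i => 'I_(\dim {:V i})))); last first.
  exact/onW_bij/fprod_of_dffun_bij.
apply: eq_bigr => b _; apply: eq_bigr => i _.
by rewrite ffunE fprodE.
Qed.

Lemma unit_tensorE r (a : mindex (fun=> 'rV[F]_r)) :
  unit_tensor r a =
  \sum_(j < r) \prod_(i : I) coord (vbasis {:'rV[F]_r}) (a i) (delta_mx 0 j).
Proof.
transitivity (\sum_(j < r) simple_tensor (fun=> delta_mx 0 j : 'rV[F]_r) a).
  exact: sum_ffunE.
by apply: eq_bigr => j _; rewrite ffunE.
Qed.

Lemma degenerates_of_sum V (s : tensor V) (r : nat) :
  sum_of_simple s r -> degenerates (unit_tensor r) s 0 0.
Proof.
move=> [u ->].
pose A i : 'M[{poly F}]_(\dim {:'rV[F]_r}, \dim {:V i}) :=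
  \matrix_(a, c) (\sum_j (vbasis {:'rV[F]_r})`_a 0 j *
                   coord (vbasis {:V i}) c (u j i))%:P.
exists A, (fun=> 0) => b; rewrite big_geq // addr0 expr0 mulr1 ffunE sum_ffunE.
rewrite rmorph_sum /=.
transitivity (\sum_(a : mindex (fun=> 'rV[F]_r)) \sum_(j < r) (\prod_i A i (a i) (b i))
    * (\prod_(i : I) coord (vbasis {:'rV[F]_r}) (a i) (delta_mx 0 j))%:P).
  apply: eq_bigr => a _; rewrite -mulr_sumr -rmorph_sum /=.
  congr (_ * polyC _); exact: unit_tensorE.
rewrite exchange_big; apply: eq_bigr => j _ /=.
under eq_bigr do rewrite rmorph_prod -big_split /=.
rewrite -(prod_sum_mindex (V := fun=> 'rV[F]_r)
  (fun i a => A i a (b i) * (coord (vbasis {:'rV[F]_r}) a (delta_mx 0 j))%:P)).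
rewrite ffunE rmorph_prod; apply: eq_bigr => i _.
under eq_bigr do rewrite mxE -polyCM mulr_suml.
rewrite -rmorph_sum exchange_big /=; congr _%:P.
transitivity (\sum_l (delta_mx 0 j : 'rV[F]_r) 0 l * coord (vbasis {:V i}) (b i) (u l i)).
  apply: eq_bigr => l _.
  rewrite {2}[delta_mx 0 j](coord_vbasis (memvf _)) summxE mulr_suml.
  by apply: eq_bigr => a _; rewrite [in RHS]mxE mulrC mulrA.
rewrite (bigD1 j) //= big1 => [|l neq_lj]; first by rewrite mxE !eqxx mul1r addr0.
by rewrite mxE (negPf neq_lj) andbF mul0r.
Qed.

Lemma degenerates_widen U V (t : tensor U) (s : tensor V) (d e : nat) :
  degenerates t s 0 0 -> (0 < #|I|)%N -> degenerates t s d e.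
Proof.
move=> [A [s_ tA]] /card_gt0P[i0 _].
exists (fun i => if i == i0 then 'X^d *: A i else A i), (fun=> 0) => b.
rewrite big1 => [|j _]; last by rewrite ffunE mul0r.
have := tA b; rewrite big_geq // !addr0 expr0 mulr1 => <-; rewrite !ffunE mulr_suml.
apply: eq_bigr => a _; rewrite mulrAC; congr (_ * _).
rewrite (bigD1 i0) //= eqxx mxE [in RHS](bigD1 i0) //= [RHS]mulrC [RHS]mulrA.
congr (_ * _); by apply: eq_bigr => i /negPf->.
Qed.

Lemma error_degree_rank_attained V (e : nat) (s : tensor V) : (0 < #|I|)%N ->
  (exists d, degenerates (unit_tensor (error_degree_rank e s)) s d e) /\
  forall r, (exists d, degenerates (unit_tensor r) s d e) ->
    (error_degree_rank e s <= r)%N.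
Proof.
move=> I_gt0; apply: leastP; exists (tensor_rank s), 0%N.
by apply/degenerates_widen/I_gt0/degenerates_of_sum; case: (tensor_rank_attained s).
Qed.

Lemma approx_degree_rank_attained V (d : nat) (s : tensor V) : (0 < #|I|)%N ->
  (exists e, degenerates (unit_tensor (approx_degree_rank d s)) s d e) /\
  forall r, (exists e, degenerates (unit_tensor r) s d e) ->
    (approx_degree_rank d s <= r)%N.
Proof.
move=> I_gt0; apply: leastP; exists (tensor_rank s), 0%N.
by apply/degenerates_widen/I_gt0/degenerates_of_sum; case: (tensor_rank_attained s).
Qed.

End Tensors.

(* No grouping of factors: the power is a tensor on 'I_n * I.                 *)
Definition tensor_power (F : fieldType) (I : finType) (V : I -> vectType F)
    (s : tensor V) (n : nat) : tensor (fun p : 'I_n * I => V p.2) :=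
  [ffun b : mindex (fun p : 'I_n * I => V p.2) =>
     \prod_(j < n) (s [ffun i : I => b (j, i)] : F)].

Lemma tensor_power_simple (F : fieldType) (I : finType) (V : I -> vectType F)
    (v : forall i, V i) (n : nat) :
  tensor_power (simple_tensor v) n = simple_tensor (fun p : 'I_n * I => v p.2).
Proof.
apply/ffunP => b; rewrite !ffunE.
transitivity (\prod_(j < n) \prod_(i : I) coord (vbasis {:V i}) (b (j, i)) (v i)).
  by apply: eq_bigr => j _; rewrite ffunE; apply: eq_bigr => i _; rewrite ffunE.
by rewrite pair_bigA; apply: eq_bigr => -[].
Qed.

(* Main.v *)
Require Import Defs.
From mathcomp Require Import all_boot all_order all_algebra.
From mathcomp Require Import boolp classical_sets functions cardinality.

(** A degeneration of the unit tensor of size r to s, with approximation degree d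
    and error degree e, yields a tensor X^d q(X) with polynomial coordinates,
    where q has degree at most e and constant term s. For each nonzero x, the
    value q(x) is the image of the unit tensor under linear maps, up to the
    scalar x^-d, hence a sum of r simple tensors
    ([horner_tensor_act_sum_of_simple]).

    The tensor power of s is then the constant term of the n-th tensor power of
    q, a family of degree at most ne. The gain over treating the factors one by
    one comes from here: degrees add up under the power, so that ne + 1 values
    determine the constant term ([coef0_interpolation]), whereas interpolating
    each factor separately would cost (e + 1)^n. Each of the values q(x)^n is a
    sum of r^n simple tensors ([sum_of_simple_power]), and ne + 1 nonzero points
    exist as soon as the field has ne + 2 elements.

    The bound in terms of d reduces to this one: the coefficient of X^d of the
    degeneration only sees the matrix entries modulo X^(d+1), and with truncated
    entries a product over k factors has degree at most kd, so that the error
    degree may be assumed to be at most (k - 1)d ([degenerates_truncate]). *)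

Set Implicit Arguments.
Unset Strict Implicit.
Unset Printing Implicit Defensive.

Import GRing.Theory.
Local Open Scope ring_scope.

(** * Sums of simple tensors *)

Section SumsOfSimple.
Variables (F : fieldType) (I : finType).
Implicit Types V : I -> vectType F.

Lemma sum_of_simple_fin V (J : finType) (u : J -> forall i, V i) :
  sum_of_simple (\sum_j simple_tensor (u j)) #|J|.
Proof.
exists (fun j => u (enum_val j)).
by rewrite -(big_enum_val (fun j => simple_tensor (u j))); apply: eq_bigl.
Qed.

(** The scalar is absorbed by the vector at the place i0: with no tensor factor
    at all, every simple tensor would be 1. *)
Lemma sum_of_simple_scale V (i0 : I) (a : F) (t : tensor V) r :
  sum_of_simple t r -> sum_of_simple (a *: t) r.
Proof.
move=> [u ->]; exists (fun j => dfwith (u j) (a *: u j i0)).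
rewrite scaler_sumr; apply: eq_bigr => j _.
rewrite -[a *: u j i0]addr0 simple_tensor_multilinear multilinear0; last first.
  exact: simple_tensor_multilinear.
rewrite addr0; congr (_ *: simple_tensor _).
by apply: functional_extensionality_dep => i; case: dfwithP.
Qed.

Lemma sum_of_simple_sum V N r (t : 'I_N -> tensor V) :
  (forall m, sum_of_simple (t m) r) -> sum_of_simple (\sum_m t m) (N * r).
Proof.
move=> /choice[u tu].
rewrite (eq_bigr _ (fun m _ => tu m)) pair_bigA /=.
have := @sum_of_simple_fin V ('I_N * 'I_r)%type (fun p => u p.1 p.2).
by rewrite card_prod !card_ord.
Qed.

End SumsOfSimple.

(** Expanding the product of n sums of r terms yields one simple tensor for each
    choice of a summand in every factor. *)
Lemma sum_of_simple_power (F : fieldType) (I : finType) (V : I -> vectType F)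
    (t : tensor V) (r n : nat) :
  sum_of_simple t r -> sum_of_simple (tensor_power t n) (r ^ n).
Proof.
move=> [u ->].
have := @sum_of_simple_fin F _ (fun p : 'I_n * I => V p.2) {ffun 'I_n -> 'I_r}
  (fun f p => u (f p.1) p.2).
rewrite card_ffun !card_ord; congr sum_of_simple; apply/ffunP => b.
rewrite sum_ffunE ffunE.
under [RHS]eq_bigr => m _.
  rewrite sum_ffunE; under eq_bigr do rewrite ffunE; over.
rewrite bigA_distr_bigA; apply: eq_bigr => f _; rewrite ffunE.
rewrite pair_bigA; apply: eq_bigr => -[m i] _ /=.
by rewrite ffunE.
Qed.

(** * Degenerations as polynomial families *)

(** The form of a degeneration suited to evaluation: the coefficients of q b are
    the coordinates at b of s and of the error tensors. *)
Lemma degenerates_polyP (F : fieldType) (I : finType) (U V : I -> vectType F)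
    (t : tensor U) (s : tensor V) (d e : nat) :
  degenerates t s d e <->
  exists A (q : mindex V -> {poly F}), forall b,
    [/\ tensor_act A t b = q b * 'X^d, (size (q b) <= e.+1)%N & (q b)`_0 = s b].
Proof.
split=> [[A [s_ tA]]|[A [q tA]]]; last first.
  exists A, (fun j => [ffun b => (q b)`_j]) => b; have [-> szq <-] := tA b.
  have {1}-> : q b = \sum_(0 <= j < e.+1) (q b)`_j *: 'X^j.
    by rewrite big_mkord -poly_def -{1}[q b](take_poly_id szq).
  rewrite big_ltn // expr0 mulrDl -mul_polyC mulr1 mulr_suml; congr (_ + _).
  by apply: eq_bigr => j _; rewrite ffunE mul_polyC -scalerAl -exprD addnC.
exists A, (fun b => \poly_(j < e.+1) (if j is 0 then s b else s_ j b)) => b.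
split; [|exact: size_poly|by rewrite coef_poly].
rewrite tA poly_def -(big_mkord xpredT (fun j => (if j is 0 then s b else s_ j b) *: 'X^j)).
rewrite big_ltn // expr0 mulrDl -mul_polyC mulr1 mulr_suml; congr (_ + _).
rewrite !big_add1; apply: eq_bigr => j _.
by rewrite mul_polyC -scalerAl -exprD addnC.
Qed.

(** Evaluation at x turns the polynomial matrices into scalar ones, which map
    each of the r simple summands of the unit tensor to a simple tensor. *)
Lemma horner_tensor_act_sum_of_simple (F : fieldType) (I : finType)
    (V : I -> vectType F) (r : nat)
    (A : forall i, 'M[{poly F}]_(\dim {:'rV[F]_r}, \dim {:V i})) (x : F) :
  sum_of_simple
    ([ffun b => (tensor_act A (unit_tensor F I r) b).[x]] : tensor V) r.
Proof.
(* w j i c is coordinate c of the image under A i of the j-th standard vector *)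
pose w j i c := \sum_a A i a c *
  (coord (vbasis {:'rV[F]_r}) a (delta_mx 0 j))%:P.
exists (fun j i => \sum_c (w j i c).[x] *: (vbasis {:V i})`_c).
apply/ffunP => b; rewrite ffunE sum_ffunE ffunE.
transitivity (\sum_(j < r) \prod_i (w j i (b i)).[x]); last first.
  apply: eq_bigr => j _; rewrite ffunE; apply: eq_bigr => i _.
  by rewrite coord_sum_free // (basis_free (vbasisP _)).
under [RHS]eq_bigr => j _.
  rewrite -horner_prod /w prod_sum_mindex; over.
rewrite -horner_sum exchange_big /=; congr (_.[x]).
apply: eq_bigr => a _; rewrite unit_tensorE rmorph_sum mulr_sumr.
by apply: eq_bigr => j _; rewrite big_split rmorph_prod.
Qed.

(** * Truncation *)

(** Truncation is reduction modulo a power of X, hence multiplicative in this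
    sense. *)
Lemma take_poly_prod (R : comNzRingType) (J : finType) m (f : J -> {poly R}) :
  take_poly m (\prod_j take_poly m (f j)) = take_poly m (\prod_j f j).
Proof.
elim/big_rec2: _ => // j p q _ IH; apply/polyP => i.
rewrite !coef_take_poly; case: ltnP => // lt_im; rewrite !coefM.
apply: eq_bigr => l _; rewrite coef_take_poly (leq_ltn_trans (leq_ord l) lt_im).
congr (_ * _); have := congr1 (fun p : {poly R} => p`_(i - l)) IH.
by rewrite !coef_take_poly (leq_ltn_trans (leq_subr _ _) lt_im).
Qed.

Lemma size_poly_prod_le_const (R : comNzRingType) (J : finType) d
    (f : J -> {poly R}) :
  (forall j, size (f j) <= d.+1)%N -> (size (\prod_j f j)%R <= #|J| * d + 1)%N.
Proof.
move=> szf; apply: leq_trans (size_poly_prod_leq _ _) _.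
rewrite leq_subLR addnA addn1 ltnS -mulnS -sum_nat_const.
exact: leq_sum.
Qed.

(** Entries of the matrices may be reduced modulo X^(d+1) without changing the
    coefficients up to X^d; the truncated products have degree at most #|I| * d,
    of which d is accounted for by the leading power of X. *)
Lemma degenerates_truncate (F : fieldType) (I : finType) (U V : I -> vectType F)
    (t : tensor U) (s : tensor V) (d e : nat) : (0 < #|I|)%N ->
  degenerates t s d e -> degenerates t s d ((#|I| - 1) * d).
Proof.
move=> I_gt0 /degenerates_polyP[A [q tA]]; apply/degenerates_polyP.
pose A' i := map_mx (take_poly d.+1) (A i).
exists A', (fun b => drop_poly d (tensor_act A' t b)) => b.
have [tAb _ q0] := tA b.
have low : take_poly d.+1 (tensor_act A' t b) = take_poly d.+1 (tensor_act A t b).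
  rewrite !ffunE !take_poly_sum; apply: eq_bigr => a _.
  rewrite ![_ * _%:P]mulrC !mul_polyC !take_polyZ; congr (_ *: _).
  by rewrite -[RHS]take_poly_prod; under eq_bigr do rewrite mxE.
have coef_low i : (i <= d)%N -> (tensor_act A' t b)`_i = (q b * 'X^d)`_i.
  move=> le_id; have := congr1 (fun p : {poly F} => p`_i) low.
  by rewrite !coef_take_poly ltnS le_id tAb.
split.
- rewrite -{1}[tensor_act A' t b](poly_take_drop d) [take_poly _ _](_ : _ = 0) ?add0r //.
  apply/polyP => i; rewrite coef_take_poly coef0; case: ltnP => // lt_id.
  by rewrite coef_low 1?ltnW // coefMXn lt_id.
- rewrite size_drop_poly leq_subLR.
  have -> : (d + ((#|I| - 1) * d).+1 = #|I| * d + 1)%N.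
    by rewrite addnS -mulSn subn1 prednK // addn1.
  rewrite ffunE; apply: leq_trans (size_sum _ _ _) _; apply/bigmax_leqP => a _.
  rewrite mulrC mul_polyC; apply: leq_trans (size_scale_leq _ _) _.
  by under eq_bigr do rewrite mxE; apply: size_poly_prod_le_const => i; exact: size_take_poly.
- by rewrite coef_drop_poly coef_low // coefMXn ltnn subnn.
Qed.

(** * Interpolation *)

(** The Vandermonde matrix of distinct points is invertible, so every
    coefficient of a polynomial of small degree is a fixed linear combination of
    its values. *)
Lemma coef0_interpolation (F : fieldType) (N : nat) (x : 'I_N -> F) :
  injective x ->
  exists c : 'I_N -> F, forall p : {poly F}, (size p <= N)%N ->
    p`_0 = \sum_m c m * p.[x m].
Proof.
move=> x_inj; pose W := Vandermonde N (\row_m x m).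
have Wu : W \in unitmx.
  rewrite unitmxE unitfE det_Vandermonde; apply/prodf_neq0 => i _.
  apply/prodf_neq0 => j lt_ij; rewrite !mxE subr_eq0 (inj_eq x_inj).
  by rewrite -val_eqE gtn_eqF.
pose c := invmx W *m (\col_l (l == 0%N :> nat)%:R).
(* c solves the linear system which says that the formula holds for monomials *)
have Wc (l : 'I_N) : \sum_m c m 0 * x m ^+ l = (l == 0%N :> nat)%:R.
  transitivity ((W *m c) l 0); last by rewrite mulmxA mulmxV // mul1mx mxE.
  by rewrite mxE; apply: eq_bigr => m _; rewrite !mxE mulrC.
exists (fun m => c m 0) => p szp.
transitivity (\sum_(l < N) p`_l * \sum_m c m 0 * x m ^+ l).
  under eq_bigr do rewrite Wc.
  case: N x x_inj W Wu c Wc szp => [|N] *.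
    by rewrite big_ord0 nth_default.
  rewrite big_ord_recl mulr1 big1 ?addr0 // => l _; exact: mulr0.
under eq_bigr do rewrite mulr_sumr.
rewrite exchange_big /=; apply: eq_bigr => m _.
rewrite (horner_coef_wide _ szp) mulr_sumr.
by apply: eq_bigr => l _; rewrite mulrCA.
Qed.

Local Open Scope card_scope.

(** Among N + 1 distinct points at most one is zero; i0 is its index, or an
    arbitrary one if there is none. *)
Lemma nonzero_points (F : fieldType) (N : nat) :
  [set: 'I_N.+1] #<= [set: F] ->
  exists x : 'I_N -> F, injective x /\ forall m, x m != 0.
Proof.
move=> /card_leP/unsquash g.
pose f i := val (g (SigSub (mem_set (Logic.I : [set: 'I_N.+1]%classic i)))).
have f_inj : injective f.
  move=> i j /val_inj gij; suff [] : SigSub (mem_set (Logic.I : [set: 'I_N.+1]%classic i))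
      = SigSub (mem_set (Logic.I : [set: 'I_N.+1]%classic j)) by [].
  by apply: (@inj _ _ _ g) gij; rewrite inE.
pose i0 := odflt ord0 [pick i | f i == 0].
exists (f \o lift i0); split=> [|m]; first exact: inj_comp f_inj (lift_inj).
apply/eqP => /= fm; have fi0 : f i0 = 0.
  rewrite /i0; case: pickP => [i /eqP//|/(_ (lift i0 m))].
  by rewrite fm eqxx.
by move: (neq_lift i0 m); rewrite -(inj_eq f_inj) fi0 fm eqxx.
Qed.

(** The power of q has degree at most n * e, so its constant term, the power of
    s, is a combination of its values at n * e + 1 points. The points have to be
    nonzero because q(x) is obtained from the unit tensor only after division by
    x^d. *)
Lemma tensor_rank_power_degenerates (F : fieldType) (I : finType)
    (V : I -> vectType F) (s : tensor V) (n d e r : nat) :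
  (0 < #|I|)%N -> (0 < n)%N -> [set: 'I_(n * e + 2)] #<= [set: F] ->
  degenerates (unit_tensor F I r) s d e ->
  (tensor_rank (tensor_power s n) <= (n * e + 1) * r ^ n)%N.
Proof.
move=> I_gt0 n_gt0 leF /degenerates_polyP[A [q tA]].
have [i0 _] := card_gt0P I_gt0.
have nI_gt0 : (0 < #|{: 'I_n * I}|)%N by rewrite card_prod card_ord muln_gt0 n_gt0.
move: leF; rewrite addnS => /nonzero_points[x [x_inj x_neq0]].
have [c cP] := coef0_interpolation x_inj.
apply: (tensor_rank_attained _ nI_gt0).2.
pose E m : tensor V := [ffun b => (q b).[x m]].
have E_simple m : sum_of_simple (E m) r.
  have -> : E m = (x m ^- d) *:
      ([ffun b => (tensor_act A (unit_tensor F I r) b).[x m]] : tensor V).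
    apply/ffunP => b; have [tAb _ _] := tA b.
    rewrite ffunE [RHS]ffunE [in RHS]ffunE tAb hornerM hornerXn.
    by rewrite [RHS]mulrC mulfK // expf_neq0.
  exact/(sum_of_simple_scale i0)/horner_tensor_act_sum_of_simple.
have -> : tensor_power s n = \sum_m c m *: tensor_power (E m) n.
  apply/ffunP => b; rewrite ffunE sum_ffunE.
  pose bl (l : 'I_n) : mindex V := [ffun i => b (l, i)].
  transitivity ((\prod_l q (bl l))`_0).
    by rewrite coef0_prod; apply: eq_bigr => l _; have [_ _ ->] := tA (bl l).
  rewrite cP => [|]; last first.
    rewrite -[n in (n * e)%N]card_ord; apply: size_poly_prod_le_const => l.
    by have [_ le_e _] := tA (bl l).
  apply: eq_bigr => m _; rewrite !ffunE horner_prod; congr (_ * _).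
  by apply: eq_bigr => l _; rewrite ffunE.
apply: sum_of_simple_sum => m.
apply: (sum_of_simple_scale (Ordinal n_gt0, i0)); exact: sum_of_simple_power.
Qed.

Theorem corollary11 (F : fieldType) (k : nat) (V : 'I_k -> vectType F)
    (s : tensor V) (n d e : nat) (hk : (1 <= k)%N) (hn : (1 <= n)%N) :
  ([set: 'I_(n * e + 2)] #<= [set: F] ->
     (tensor_rank (tensor_power s n) <= (n * e + 1) * error_degree_rank e s ^ n)%N)
  /\
  ([set: 'I_((k - 1) * n * d + 2)] #<= [set: F] ->
     (tensor_rank (tensor_power s n)
        <= ((k - 1) * n * d + 1) * approx_degree_rank d s ^ n)%N).
Proof.
have I_gt0 : (0 < #|'I_k|)%N by rewrite card_ord.
split=> leF.
  have [[d' sP] _] := error_degree_rank_attained e s I_gt0.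
  exact: tensor_rank_power_degenerates leF sP.
have [[e' sP] _] := approx_degree_rank_attained d s I_gt0.
move: leF; rewrite [((k - 1) * n)%N]mulnC -mulnA => leF.
apply: tensor_rank_power_degenerates leF _ => //.
by have := degenerates_truncate I_gt0 sP; rewrite card_ord; apply.
Qed.
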